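(* A (finite simple) graph $G$ is a cpsd-graph if and only if $G$ has no subgraph isomorphic to the cycle $C_{2t+1}$ for any integer $t\ge 2$.
   Context: Graphs have vertex set $[n]$ and no loops or multiple edges. A subgraph of $G$ is a graph whose vertex and edge sets are subsets of those of $G$. The cycle $C_k$ has vertex set $[k]$ with $u\sim v$ iff $u-v\equiv \pm1 \pmod k$. A real symmetric matrix is doubly nonnegative (DNN) if it is positive semidefinite and entrywise nonnegative. An $n\times n$ matrix $X$ is completely positive semidefinite (cpsd) if there exist $d\ge1$ and Hermitian positive semidefinite $d\times d$ matrices $P_1,\dots,P_n$ with $X_{ij}=\mathrm{Tr}(P_iP_j)$ for all $i,j$. The support graph $S(X)$ of a symmetric $n\times n$ matrix $X$ is the graph on $[n]$ with $u\sim v$ iff $u\neq v$ and $X_{uv}\neq 0$. A graph $G$ on $[n]$ is a cpsd-graph if every $n\times n$ doubly nonnegative matrix $X$ with $S(X)=G$ is cpsd. *)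

(* Defs.v *)
(* real numbers are an arbitrary R : realType (e.g. the reals),
   complex numbers are R[i] from mathcomp-real-closed. *)
From HB Require Import structures.
From mathcomp Require Import all_boot all_order all_algebra.
From mathcomp Require Import complex.
From mathcomp Require Import reals.
Set Implicit Arguments. Unset Strict Implicit. Unset Printing Implicit Defensive.
Import Order.TTheory GRing.Theory Num.Theory.
Local Open Scope ring_scope.

(** Simple graphs on [n] = 'I_n : an irreflexive symmetric relation. *)
Definition simple_graph (n : nat) (G : rel 'I_n) : Prop :=
  (forall u, ~~ G u u) /\ (forall u v, G u v = G v u).

(** The cycle C_k on 'I_k : u ~ v iff u - v = +-1 (mod k). *)
Definition cycle_graph (k : nat) : rel 'I_k :=
  fun u v => (u == (v + 1) %[mod k]) || (v == (u + 1) %[mod k]).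

(** H (on 'I_k) is isomorphic to a subgraph of G (on 'I_n): there is a
    subgraph (V, E) of G (V a vertex subset, E an edge set contained in the
    edges of G, with endpoints in V) and a bijection f : 'I_k -> V which is a
    graph isomorphism from H onto (V, E). *)
Definition has_subgraph_iso (n k : nat) (G : rel 'I_n) (H : rel 'I_k) : Prop :=
  exists (V : {set 'I_n}) (E : rel 'I_n) (f : 'I_k -> 'I_n),
    (forall u v, E u v -> [&& G u v, u \in V & v \in V]) /\
    (forall u v, E u v = E v u) /\
    injective f /\ (forall v, v \in V -> exists i, f i = v) /\
    (forall i, f i \in V) /\
    (forall i j, H i j = E (f i) (f j)).

(** Real symmetric positive semidefinite matrices. *)
Definition psd_real (R : realType) (n : nat) (X : 'M[R]_n) : Prop :=
  X^T = X /\ forall v : 'cV[R]_n, 0 <= (v^T *m X *m v) 0 0.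

(** Doubly nonnegative: positive semidefinite and entrywise nonnegative. *)
Definition DNN (R : realType) (n : nat) (X : 'M[R]_n) : Prop :=
  psd_real X /\ forall i j, 0 <= X i j.

(** Conjugate transpose of a complex matrix. *)
Definition adjmx (R : realType) (m p : nat) (A : 'M[R[i]]_(m, p)) : 'M[R[i]]_(p, m) :=
  (map_mx (fun z : R[i] => z^*) A)^T.

(** Hermitian positive semidefinite complex matrices
    (0 <= z in R[i] means z is real and nonnegative). *)
Definition herm_psd (R : realType) (d : nat) (P : 'M[R[i]]_d) : Prop :=
  adjmx P = P /\ forall v : 'cV[R[i]]_d, 0 <= (adjmx v *m P *m v) 0 0.

(** Completely positive semidefinite. *)
Definition cpsd (R : realType) (n : nat) (X : 'M[R]_n) : Prop :=
  exists (d : nat) (P : 'I_n -> 'M[R[i]]_d), (1 <= d)%N /\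
    (forall i, herm_psd (P i)) /\
    (forall i j, ((X i j)%:C)%C = \tr (P i *m P j)).

(** Support graph of a symmetric matrix. *)
Definition support_graph (R : realType) (n : nat) (X : 'M[R]_n) : rel 'I_n :=
  fun u v => (u != v) && (X u v != 0).

(** cpsd-graph. *)
Definition cpsd_graph (R : realType) (n : nat) (G : rel 'I_n) : Prop :=
  forall X : 'M[R]_n, DNN X -> support_graph X =2 G -> cpsd X.

(* Main.v *)
Require Import Defs.
From HB Require Import structures.
From mathcomp Require Import classical_sets.
From mathcomp Require Import all_boot all_order all_algebra.
From mathcomp Require Import complex reals.
From mathcomp Require Import zify ring lra.
Set Implicit Arguments. Unset Strict Implicit. Unset Printing Implicit Defensive.
Import Order.TTheory GRing.Theory Num.Theory.

(* If: a doubly nonnegative matrix M whose support graph has no odd cycle of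
   length at least 5 is completely positive, by induction on the number of edges.
   Such a graph is bipartite, or has a non-isolated vertex whose neighbours form a
   clique, or has a cut vertex with edges on both sides. In the bipartite case a
   sign change makes M a psd Z-matrix; then M is diagonally dominant after a
   positive diagonal scaling and splits into edge contributions. In the second
   case, a multiple of x x^T, with x the column of the vertex, can be subtracted
   so as to remove an edge. In the third, M splits along the cut vertex.

   Only if: on an odd cycle there is d > 0 such that
   sum_i (x_i + x_(i+1))^2 >= 2 d sum_i x_i^2, so the matrix with diagonal 2 - d,
   with 1 on the cycle edges and a small e on the remaining edges of G is doubly
   nonnegative. It is not cpsd: if tr (P_(i-1) P_(i+1)) <= e for all i, then the
   spectral projection of P_(i+1) - P_(i-1) on its positive part almost fixes
   P_(i+1) and almost kills P_(i-1). It therefore splits the norm of P_i between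
   the edges {i-1, i} and {i, i+1}, and Cauchy-Schwarz on each edge yields
   2 sum_i tr (P_i P_(i+1)) <= sum_i tr (P_i^2) + O(sqrt e). *)

(** * Graphs without long odd cycles *)

(** A repeated vertex cuts a closed walk into two shorter closed walks. Their lengths have an odd
    sum, so one of them is odd and the induction applies to it. *)
Lemma odd_cycle_uniq (T : eqType) (e : rel T) (s : seq T) :
  cycle e s -> odd (size s) ->
  exists s', [/\ uniq s', cycle e s' & odd (size s')].
Proof.
have [n] := ubnP (size s); elim: n s => // n IHn s; rewrite ltnS => size_s cs odd_s.
have [us|nus] := boolP (uniq s); first by exists s.
have [x [s1 [s2 [s3 def_s]]]] :
    exists x s1 s2 s3, s = s1 ++ x :: s2 ++ x :: s3.
  elim: s nus {size_s cs odd_s} => //= x s IHs; rewrite negb_and negbK.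
  case/orP=> [/splitPr[p1 p2]|/IHs[y [s1 [s2 [s3 ->]]]]].
    by exists x, [::], p1, p2.
  by exists y, (x :: s1), s2, s3.
have rot_s : rot (size s1) s = (x :: s2) ++ (x :: s3 ++ s1).
  by rewrite def_s rot_size_cat /= -catA.
have size_eq : size s = (size (x :: s2) + size (x :: s3 ++ s1))%N.
  by rewrite -size_cat -rot_s size_rot.
move: cs; rewrite -(rot_cycle (size s1)) rot_s /= rcons_cat cat_path /=.
case/and3P=> p2 lx p3.
have c2 : cycle e (x :: s2) by rewrite /= rcons_path p2.
have c3 : cycle e (x :: s3 ++ s1) by [].
move: odd_s; rewrite size_eq oddD.
case odd2: (odd (size (x :: s2))) => odd3.
  by apply: (IHn _ _ c2 odd2); move: size_s; rewrite size_eq /=; lia.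
by apply: (IHn _ _ c3 odd3); move: size_s; rewrite size_eq /=; lia.
Qed.

Section Graph.
Variables (T : finType) (G : rel T).
Hypothesis Gsym : forall u v, G u v = G v u.
Hypothesis Girr : forall u, ~~ G u u.

(** The bipartite double cover: its paths are the walks of [G], with the parity of the number of
    steps recorded. *)
Definition double_cover : rel (T * bool) :=
  fun x y => G x.1 y.1 && (y.2 == ~~ x.2).

Lemma double_cover_odd_cycle v :
  connect double_cover (v, false) (v, true) ->
  exists s, cycle G s /\ odd (size s).
Proof.
case/connectP=> p pp lp.
have gp x q : path double_cover x q -> path G x.1 (map fst q).
  by elim: q x => //= y q IHq x /andP[/andP[-> _] /IHq].
have par x q : path double_cover x q -> (last x q).2 = x.2 (+) odd (size q).
  elim: q x => [x|y q IHq x] /=; first by rewrite addbF.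
  by case/andP=> /andP[_ /eqP y2] /IHq ->; rewrite y2 addNb addbN.
have odd_p : odd (size p) by have := par _ _ pp; rewrite -lp.
case: p => [|y p] // in pp lp odd_p *.
exists (map fst (y :: p)); split; last by rewrite size_map.
have lv : last y.1 (map fst p) = v by rewrite last_map -[last y p]lp.
by have := gp _ _ pp; rewrite /= rcons_path lv andbC.
Qed.

(** If no [(v, false)] reaches [(v, true)], each vertex is reached from the root of its component in
    exactly one parity, and that parity is a proper colouring. *)
Lemma bipartite_or_odd_cycle :
  (exists col : T -> bool, forall u v, G u v -> col u != col v) \/
  (exists s, [/\ uniq s, cycle G s & odd (size s)]).
Proof.
have [/existsP[v vv]|nov] :=
    boolP [exists v, connect double_cover (v, false) (v, true)].
  by right; have [s [cs os]] := double_cover_odd_cycle vv; apply: odd_cycle_uniq cs os.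
left; have Gc : connect_sym G by apply: sym_connect_sym => u v; rewrite Gsym.
have Dc : connect_sym double_cover.
  apply: sym_connect_sym => [[u b] [v c]]; rewrite /double_cover /= Gsym.
  by congr (_ && _); case: b c => [] [].
have nov' v : connect double_cover (v, false) (v, true) = false.
  by apply/negP=> vv; case/negP: nov; apply/existsP; exists v.
pose r := fingraph.root G.
have reach v : connect double_cover (r v, false) (v, false)
            \/ connect double_cover (r v, false) (v, true).
  have : connect G (r v) v by rewrite Gc connect_root.
  case/connectP=> p; elim/last_ind: p v => [|p y IHp] v.
    by move=> _ /= {2}->; left; rewrite connect0.
  rewrite rcons_path last_rcons => /andP[pp ly] vy; subst v.
  have ryz : r (last (r y) p) = r y.
    by apply/esym/(fingraph.rootP Gc); rewrite Gc connect1.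
  have := IHp (last (r y) p); rewrite ryz => /(_ pp erefl) [] c; [right|left];
    by apply: connect_trans c (connect1 _); rewrite /double_cover /= ly.
exists (fun v => connect double_cover (r v, false) (v, false)) => u v uv.
have ruv : r u = r v by apply/(fingraph.rootP Gc); rewrite connect1.
apply/negP => /eqP; rewrite ruv.
have Duv b c : connect double_cover (r v, false) (u, b) ->
    connect double_cover (r v, false) (v, c) -> b = c -> False.
  move=> cu cv bc; subst c.
  have cuu: connect double_cover (v, b) (u, b).
    by apply: connect_trans cu; rewrite Dc.
  have cuv : connect double_cover (u, b) (v, ~~ b).
    by apply: connect1; rewrite /double_cover /= uv /=.
  have cvv := connect_trans cuu cuv.
  by case: b cvv {cu cv cuu cuv} => /= cvv; first rewrite Dc in cvv;
    rewrite nov' in cvv.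
case cu: (connect _ _ (u, false)) => cv.
  exact: (Duv false false).
have [|cu'] := reach u; first by rewrite ruv cu.
have [|cv'] := reach v; first by rewrite -cv.
by rewrite ruv in cu'; apply: (Duv true true).
Qed.

Hypothesis no_long_odd_cycle :
  forall s, uniq s -> cycle G s -> odd (size s) -> size s < 5.

Lemma bipartite_or_triangle :
  (exists col : T -> bool, forall u v, G u v -> col u != col v) \/
  (exists a b c, [/\ G a b, G b c & G c a]).
Proof.
have [|[s [us cs os]]] := bipartite_or_odd_cycle; first by left.
right; have lt5 := no_long_odd_cycle us cs os; move: lt5 os cs.
case: s {us} => [|a [|b [|c [|d [|]]]]] //= _ _.
  by rewrite (negPf (Girr a)).
by case/and4P=> ab bc ca _; exists a, b, c.
Qed.

Definition off_triangle a b c : rel T := fun x y =>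
  [&& G x y, x \notin [:: a; b; c] & y \notin [:: a; b; c]].

(* A path from h to y off the triangle with at least two vertices closes through
   b a and through b c a into two cycles of opposite parities, of lengths >= 4
   and >= 5; the odd one is excluded. *)
Lemma attached_same a b c h y : G a b -> G b c -> G c a ->
  h \notin [:: a; b; c] ->
  connect (off_triangle a b c) h y -> G a h -> G b y -> y = h.
Proof.
move=> ab bc ca hT /connectP[p0 pp0 ly0] ah bY.
case/shortenP: pp0 ly0 => p pp up _ ly.
have out z : z \in h :: p -> z \notin [:: a; b; c].
  rewrite inE; case/orP=> [/eqP->//|].
  elim: p h pp {up ly ah hT} => //= x p IHp h /andP[/and3P[_ _ xT] /IHp IH].
  by rewrite inE => /orP[/eqP->|/IH].
have Gp : path G h p by apply: sub_path pp => x z /andP[].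
case: p => [|x p] // in pp up ly out Gp *.
have last_b : G (last h (x :: p)) b by rewrite -ly Gsym.
have notin z : z \in [:: a; b; c] -> z \notin h :: x :: p.
  by apply: contraL => /out.
have ha : a \notin h :: x :: p by apply: notin; rewrite !inE eqxx.
have hb : b \notin h :: x :: p by apply: notin; rewrite !inE eqxx orbT.
have hc : c \notin h :: x :: p by apply: notin; rewrite !inE eqxx !orbT.
have nab : a != b by apply: contraTneq ab => ->; rewrite Girr.
have nbc : b != c by apply: contraTneq bc => ->; rewrite Girr.
have nca : c != a by apply: contraTneq ca => ->; rewrite Girr.
have pa : path G a (h :: x :: p) by rewrite /= ah.
have pab : path G a (rcons (h :: x :: p) b) by rewrite rcons_path pa.
case os : (odd (size p)).
  have := @no_long_odd_cycle (a :: rcons (h :: x :: p) b).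
  rewrite cons_uniq rcons_uniq mem_rcons in_cons negb_or hb nab ha up.
  rewrite /cycle rcons_path pab last_rcons Gsym ab => /(_ isT isT).
  by rewrite /= size_rcons /= !negbK os => /(_ isT); case: (p) os => [|? []].
have := @no_long_odd_cycle (a :: rcons (rcons (h :: x :: p) b) c).
have ca' : c \notin rcons (h :: x :: p) b.
  by rewrite mem_rcons in_cons negb_or eq_sym nbc.
have aa' : a \notin rcons (rcons (h :: x :: p) b) c.
  by rewrite mem_rcons in_cons negb_or eq_sym nca mem_rcons in_cons negb_or nab.
rewrite cons_uniq !rcons_uniq aa' ca' hb up.
rewrite /cycle !rcons_path !last_rcons -rcons_path pab bc ca => /(_ isT isT).
by rewrite /= !size_rcons /= !negbK os => /(_ isT).
Qed.

Definition simplicial v := forall i j, i != j -> G v i -> G v j -> G i j.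

(** The last two clauses ask for an edge on either side, an edge at [v] being allowed, so that both
    pieces of a matrix split at [v] lose an edge. *)
Definition cut v (A : {set T}) :=
  [/\ v \notin A, forall i j, i \in A -> j \notin A -> j != v -> ~~ G i j,
      exists i j, i \in A /\ G i j &
      exists i j, [/\ i \notin A, j \notin A & G i j]].

(** Let [K] be the component of [h] off the triangle. If [K] is attached to [a] alone, [a] separates
    [K] from the edge [b c]. Otherwise [h] is the only attached vertex of [K]: either it separates
    the rest of [K] from the triangle, or [K] is [h] alone and the neighbours of [h] lie in the
    triangle, a clique. *)
Lemma attached_reduction a b c h : G a b -> G b c -> G c a ->
  h \notin [:: a; b; c] -> G a h ->
  (exists v u, simplicial v /\ G v u) \/ (exists v A, cut v A).
Proof.
move=> ab bc ca hT ah; pose e := off_triangle a b c.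
have ec : connect_sym e.
  by apply: sym_connect_sym => x y; rewrite /e /off_triangle Gsym [X in _ && X]andbC.
have out y : connect e h y -> y \notin [:: a; b; c].
  case/connectP=> p; elim/last_ind: p y => [|p z IHp] y; first by move=> _ ->.
  by rewrite rcons_path last_rcons => /andP[_ /and3P[_ _ zT]] ->.
have stay y z : connect e h y -> G y z -> z \notin [:: a; b; c] -> connect e h z.
  move=> cy yz zT; apply: (connect_trans cy); apply: connect1.
  by apply/and3P; split=> //; apply: out.
(* Attachment to a second triangle vertex forces h to be the only attached vertex. *)
have common b' c' : G a b' -> G b' c' -> G c' a ->
    (forall x, (x \in [:: a; b'; c']) = (x \in [:: a; b; c])) ->
    (exists2 y, connect e h y & G b' y) ->
    (exists v u, simplicial v /\ G v u) \/ (exists v A, cut v A).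
  move=> ab' bc' ca' mT [y0 cy0 by0].
  have e' : off_triangle a b' c' =2 e.
    by move=> x y; rewrite /e /off_triangle !mT.
  have ce x y : connect (off_triangle a b' c') x y = connect e x y.
    exact: eq_connect.
  have hT' : h \notin [:: a; b'; c'] by rewrite mT.
  have y0h : y0 = h.
    by apply: (attached_same ab' bc' ca' hT') => //; rewrite ce.
  subst y0.
  have attb y : connect e h y -> G b' y -> y = h.
    by move=> cy; apply: (attached_same ab' bc' ca' hT') => //; rewrite ce.
  have atta y : connect e h y -> G a y -> y = h.
    move=> cy ay; apply: (@attached_same b' a c' h y) => //; rewrite 1?Gsym //.
    - by apply: contra hT'; rewrite !inE => /or3P[]->; rewrite ?orbT.
    - rewrite (@eq_connect _ _ e) // => u w; rewrite -e' /off_triangle !inE.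
      by rewrite (orbCA (u == b')) (orbCA (w == b')).
  have attc y : connect e h y -> G c' y -> y = h.
    move=> cy cy'; apply: (@attached_same a c' b' h y) => //; rewrite 1?Gsym //.
    - by apply: contra hT'; rewrite !inE => /or3P[]->; rewrite ?orbT.
    - rewrite (@eq_connect _ _ e) // => u w; rewrite -e' /off_triangle !inE.
      by rewrite (orbC (u == c')) (orbC (w == c')).
  have att y z : connect e h y -> G y z -> z \in [:: a; b; c] -> y = h.
    move=> cy yz; rewrite -mT !inE => /or3P[] /eqP zE; subst z;
      rewrite Gsym in yz; [exact: atta | exact: attb | exact: attc].
  have [/existsP[y /andP[cy yh]]|nex] := boolP [exists y, connect e h y && (y != h)].
    right; exists h, [set z | connect e h z && (z != h)]; split.
    - by rewrite inE eqxx andbF.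
    - move=> i j; rewrite !inE => /andP[ci ih] nj jh; rewrite jh andbT in nj.
      apply/negP=> ij; have [jT|jT] := boolP (j \in [:: a; b; c]).
        by rewrite (att i j ci ij jT) eqxx in ih.
      by rewrite (stay i j ci ij jT) in nj.
    - exists y; have := cy; rewrite ec => /connectP[[|z p] /=].
        by move=> _ hy; rewrite hy eqxx in yh.
      by case/andP=> /andP[yz _] _ _; exists z; rewrite inE cy yh.
    - exists a, b; split=> //; rewrite inE negb_and;
      by apply/orP; left; apply/negP => /out; rewrite !inE eqxx ?orbT.
  left; exists h, a; split; last by rewrite Gsym.
  have hN i : G h i -> i \in [:: a; b; c].
    move=> hi; apply: contraT => iT.
    have ih : i != h by apply: contraTneq hi => ->; rewrite Girr.
    case/existsP: nex; exists i; rewrite ih andbT.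
    exact: (stay h i (connect0 _ _) hi iT).
  move=> i j + /hN iT /hN jT; move: iT jT; rewrite !inE.
  by case/or3P=> /eqP-> /or3P[] /eqP->; rewrite ?eqxx // Gsym.
have [/existsP[y /andP[cy yb]]|nb] := boolP [exists y, connect e h y && G b y].
  by apply: (common b c) => //; exists y.
have [/existsP[y /andP[cy yc]]|nc] := boolP [exists y, connect e h y && G c y].
  apply: (common c b); rewrite 1?Gsym //; last by exists y.
  by move=> x; rewrite !inE (orbC (x == c)).
right; exists a, [set z | connect e h z]; split.
- by rewrite inE; apply/negP => /out; rewrite !inE eqxx.
- move=> i j; rewrite !inE => ci nj ja.
  apply/negP=> ij; have [jT|jT] := boolP (j \in [:: a; b; c]).
    move: jT; rewrite !inE (negPf ja) /= => /orP[] /eqP jE; subst j.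
      by case/existsP: nb; exists i; rewrite ci Gsym.
    by case/existsP: nc; exists i; rewrite ci Gsym.
  by rewrite (stay i j ci ij jT) in nj.
- by exists h, a; rewrite inE connect0 Gsym.
- exists b, c; split=> //; rewrite inE;
    by apply/negP => /out; rewrite !inE eqxx ?orbT.
Qed.

(** In a triangle [a b c], either [a] has only [b] and [c] as neighbours and is simplicial, or a
    neighbour of [a] off the triangle starts [attached_reduction]. *)
Lemma graph_reduction :
  [\/ exists col : T -> bool, forall u v, G u v -> col u != col v,
      exists v u, simplicial v /\ G v u
    | exists v A, cut v A].
Proof.
have [|[a [b [c [ab bc ca]]]]] := bipartite_or_triangle; first by constructor 1.
suff [|] : (exists v u, simplicial v /\ G v u) \/ (exists v A, cut v A).
- by constructor 2.
- by constructor 3.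
have [/existsP[h /andP[hT ah]]|na] :=
    boolP [exists h, (h \notin [:: a; b; c]) && G a h].
  exact: attached_reduction ab bc ca hT ah.
left; exists a, b; split=> //.
have aN i : G a i -> i \in [:: b; c].
  move=> ai; have ia : i != a by apply: contraTneq ai => ->; rewrite Girr.
  apply: contraT => iT; case/existsP: na; exists i.
  by rewrite in_cons negb_or ia iT.
move=> i j + /aN iT /aN jT; move: iT jT; rewrite !inE.
by case/orP=> /eqP-> /orP[] /eqP->; rewrite ?eqxx // Gsym.
Qed.

End Graph.

(** * Complete positivity *)

Local Open Scope ring_scope.

(** * Positive semidefinite forms, Schur complements and Z-matrices *)

Section QuadraticForms.
Variables (R : realFieldType) (T : finType).
Implicit Types (M : T -> T -> R) (x y z : T -> R).

Definition bform M x y := \sum_i \sum_j x i * M i j * y j.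

Definition psd M := (forall i j, M i j = M j i) /\ forall x, 0 <= bform M x x.

Lemma sum_delta (v : T) (F : T -> R) : \sum_i (i == v)%:R * F i = F v.
Proof.
rewrite (bigD1 v) //= eqxx mul1r big1 ?addr0 // => i /negPf ->.
by rewrite mul0r.
Qed.

Lemma eq_bform M M' x y : M =2 M' -> bform M x y = bform M' x y.
Proof. by move=> e; apply: eq_bigr => i _; apply: eq_bigr => j _; rewrite e. Qed.

Lemma bformDM M N x y :
  bform (fun i j => M i j + N i j) x y = bform M x y + bform N x y.
Proof.
rewrite -big_split; apply: eq_bigr => i _; rewrite -big_split.
by apply: eq_bigr => j _ /=; ring.
Qed.

Lemma bformZM a M x y : bform (fun i j => a * M i j) x y = a * bform M x y.
Proof.
rewrite mulr_sumr; apply: eq_bigr => i _; rewrite mulr_sumr.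
by apply: eq_bigr => j _ /=; ring.
Qed.

Lemma bform_outer a b x y :
  bform (fun i j => a i * b j) x y = (\sum_i a i * x i) * (\sum_i b i * y i).
Proof.
rewrite mulr_suml; apply: eq_bigr => i _; rewrite mulr_sumr.
by apply: eq_bigr => j _; ring.
Qed.

Lemma bform_shift M x v t : (forall i j, M i j = M j i) ->
  let x' i := x i + t * (i == v)%:R in
  bform M x' x' = bform M x x + 2 * t * (\sum_j M v j * x j) + t ^+ 2 * M v v.
Proof.
move=> sM x'.
have -> : bform M x' x' = bform M x x
    + t * (\sum_i (i == v)%:R * (\sum_j M i j * x j))
    + t * (\sum_i \sum_j (j == v)%:R * (x i * M i j))
    + t ^+ 2 * (\sum_i (i == v)%:R * (\sum_j (j == v)%:R * M i j)).
  rewrite !mulr_sumr -!big_split; apply: eq_bigr => i _ /=.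
  rewrite !mulr_sumr -!big_split; apply: eq_bigr => j _ /=.
  by rewrite /x'; ring.
rewrite !sum_delta.
have -> : \sum_i \sum_j (j == v)%:R * (x i * M i j) = \sum_i M v i * x i.
  by apply: eq_bigr => i _; rewrite sum_delta sM mulrC.
ring.
Qed.

Lemma psd_diag_ge0 M v : psd M -> 0 <= M v v.
Proof.
move=> [sM pM]; have := pM (fun i => 0 + 1 * (i == v)%:R).
rewrite bform_shift // /bform big1 => [|i _]; last first.
  by rewrite big1 // => j _; rewrite mulr0.
by rewrite big1 => [|j _]; rewrite ?mulr0 // add0r add0r expr1n mul1r.
Qed.

(** Along the line through [x] in direction [v] the form is a nonnegative polynomial of degree at
    most 2 in [t]; its minimum gives the bound. *)
Lemma psd_cauchy_schwarz M x v : psd M ->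
  (\sum_j M v j * x j) ^+ 2 <= M v v * bform M x x.
Proof.
move=> pM; have Mvv := psd_diag_ge0 v pM; case: pM => sM pM.
set c := \sum_j _; set q := bform M x x.
have key t : 0 <= q + 2 * t * c + t ^+ 2 * M v v.
  by rewrite -bform_shift.
have [M0|Mn0] := eqVneq (M v v) 0.
  have [->|c0] := eqVneq c 0; first by rewrite M0 mul0r expr0n.
  (* With [M v v = 0] the polynomial is affine, and this [t] gives it the value [-1]. *)
  have := key (- (q + 1) / (2 * c)).
  have -> : q + 2 * (- (q + 1) / (2 * c)) * c + (- (q + 1) / (2 * c)) ^+ 2 * M v v = -1.
    by rewrite M0; field.
  by rewrite ler0N1.
have Mgt0 : 0 < M v v by rewrite lt_def Mn0.
have := key (- c / M v v).
have -> : q + 2 * (- c / M v v) * c + (- c / M v v) ^+ 2 * M v v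
   = (M v v * q - c ^+ 2) / M v v by field.
by rewrite pmulr_lge0 ?invr_gt0 // subr_ge0.
Qed.

Lemma psd_entry_sq M u v : psd M -> M v u ^+ 2 <= M v v * M u u.
Proof.
move=> pM; have := psd_cauchy_schwarz (fun i => (i == u)%:R) v pM.
under eq_bigr do rewrite mulrC.
rewrite sum_delta; congr (_ <= _ * _); rewrite /bform.
rewrite (eq_bigr (fun i => (i == u)%:R * M i u)) ?sum_delta // => i _.
rewrite -(sum_delta u (M i)) mulr_sumr; apply: eq_bigr => j _; ring.
Qed.

Lemma psd_diag_gt0 M u v : psd M -> M v u != 0 -> 0 < M v v.
Proof.
move=> pM Mvu; rewrite lt_def psd_diag_ge0 // andbT.
apply: contraNneq Mvu => M0; have := psd_entry_sq u v pM.
by rewrite M0 mul0r -sqrf_eq0 eq_le sqr_ge0 => ->.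
Qed.

(** At [s = 1 / M v v] this is the Schur complement. In general the subtracted form is [s] times a
    square, which Cauchy-Schwarz bounds by [M v v] times the form of [M]. *)
Lemma psd_schur M v s : psd M -> 0 <= s -> s * M v v <= 1 ->
  psd (fun i j => M i j - s * (M v i * M v j)).
Proof.
move=> pM s0 s1; split=> [i j|x]; first by rewrite pM.1; ring.
have -> : bform (fun i j => M i j - s * (M v i * M v j)) x x
    = bform M x x - s * (\sum_j M v j * x j) ^+ 2.
  rewrite -[- (s * _)]mulNr expr2 -bform_outer -bformZM -bformDM.
  by apply: eq_bform => i j; rewrite mulNr.
rewrite subr_ge0; apply: le_trans (ler_wpM2l s0 (psd_cauchy_schwarz x v pM)) _.
by rewrite mulrA ler_piMl // pM.2.
Qed.

(** Gaussian elimination: the Schur complement at a non-isolated index [v] is again a psd Z-matrix,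
    now with row [v] zero, so [supp] shrinks. A vector found for it serves for [M] once its
    coordinate at [v] is recomputed. *)
Lemma zmatrix_positive_vector M : psd M -> (forall i j, i != j -> M i j <= 0) ->
  exists d : T -> R, (forall i, 0 < d i) /\ forall i, 0 <= \sum_j M i j * d j.
Proof.
pose supp K := [set v : T | [exists u, (u != v) && (K v u != 0 :> R)]].
have [n] := ubnP #|supp M|.
elim: n M => // n IHn M; rewrite ltnS => leMn pM zM.
have [v|nov] := pickP [pred v | [exists u, (u != v) && (M v u != 0)]]; last first.
  exists (fun=> 1); split=> [//|i]; rewrite (bigD1 i) //= big1 => [|j ji].
    by rewrite addr0 mulr1 psd_diag_ge0.
  have /existsPn/(_ j) := negbT (nov i); rewrite ji /= negbK => /eqP ->.
  by rewrite mul0r.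
move=> /= exv; case/existsP: (exv) => u /andP[uv Mvu].
have Mvv := psd_diag_gt0 pM Mvu.
pose N i j := M i j - (M v v)^-1 * (M v i * M v j).
have Nv j : N v j = 0 by rewrite /N mulrA mulVf ?gt_eqF // mul1r subrr.
have pN : psd N.
  apply: psd_schur => //; first by rewrite invr_ge0 ltW.
  by rewrite mulVf ?gt_eqF.
have N0 i j : j != i -> (forall u, u != i -> M i u = 0) -> N i j = 0.
  move=> ji M0; have [->|iv] := eqVneq i v; first exact: Nv.
  by rewrite /N M0 // (pM.1 v i) M0 1?eq_sym // mul0r mulr0 subrr.
have ltN : (#|supp N| < n)%N.
  apply: leq_trans leMn; apply/proper_card/properP; split.
    apply/subsetP=> i; rewrite !inE; apply: contraLR => /existsPn noi.
    apply/existsPn => j; apply/andP=> -[ji /eqP[]].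
    rewrite N0 // => k ki; have := noi k; rewrite ki /= negbK; exact/eqP.
  exists v; rewrite !inE //; apply/existsPn => j.
  by rewrite Nv eqxx andbF.
have zN i j : i != j -> N i j <= 0.
  move=> ij; have [->|iv] := eqVneq i v; first by rewrite Nv.
  have [->|jv] := eqVneq j v; first by rewrite pN.1 Nv.
  rewrite subr_le0; apply: le_trans (zM _ _ ij) _.
  apply: mulr_ge0; first by rewrite invr_ge0 ltW.
  by rewrite mulr_le0 ?zM // eq_sym.
have [d [d0 dN]] := IHn N ltN pN zN.
(* This coordinate makes row [v] of the product with [M] vanish, and is positive because
   [M v u < 0]. The other rows then agree with those of [N d]. *)
pose s := - (\sum_(j | j != v) M v j * d j) / M v v.
have s0 : 0 < s.
  rewrite divr_gt0 // oppr_gt0 (bigD1 u) //=.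
  rewrite ltr_nwDl //.
    by rewrite pmulr_llt0 // lt_def eq_sym Mvu zM // eq_sym.
  apply: sumr_le0 => j /andP[jv _]; rewrite pmulr_lle0 // zM // eq_sym //.
exists (fun j => if j == v then s else d j); split=> [i|i]; first by case: ifP.
have Es i' : \sum_j M i' j * (if j == v then s else d j)
    = M i' v * s + \sum_(j | j != v) M i' j * d j.
  rewrite (bigD1 v) //= eqxx; congr (_ + _).
  by apply: eq_bigr => j /negPf ->.
have EN : \sum_(j | j != v) N i j * d j = \sum_j N i j * d j.
  by rewrite [RHS](bigD1 v) //= pN.1 Nv mul0r add0r.
have := dN i; rewrite -EN Es => /le_trans; apply.
have -> : \sum_(j | j != v) N i j * d j = \sum_(j | j != v) M i j * d j
    - (M v v)^-1 * M v i * \sum_(j | j != v) M v j * d j.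
  rewrite mulr_sumr -sumrB; apply: eq_bigr => j _; rewrite /N; ring.
by rewrite /s (pM.1 i v) le_eqVlt; apply/orP; left; apply/eqP; ring.
Qed.

End QuadraticForms.

(** * Sums of squares of nonnegative vectors, and the bipartite case *)

Section CompletelyPositive.
Variables (R : rcfType) (T : finType).
Implicit Types (M : T -> T -> R).

Definition completely_positive M := exists s : seq {ffun T -> R},
  (forall b, b \in s -> forall i, 0 <= b i) /\
  forall i j, M i j = \sum_(b <- s) b i * b j.

Lemma cp_eq M N : M =2 N -> completely_positive M -> completely_positive N.
Proof. by move=> e [s [s0 sM]]; exists s; split=> // i j; rewrite -e. Qed.

Lemma cp_add M N : completely_positive M -> completely_positive N ->
  completely_positive (fun i j => M i j + N i j).
Proof.
move=> [s [s0 sM]] [t [t0 tN]]; exists (s ++ t); split=> [b|i j].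
  by rewrite mem_cat => /orP[/s0|/t0].
by rewrite big_cat sM tN.
Qed.

Lemma cp_combination (I : finType) (c : I -> R) (b : I -> T -> R) :
  (forall l, 0 <= c l) -> (forall l i, 0 <= b l i) ->
  completely_positive (fun i j => \sum_l c l * (b l i * b l j)).
Proof.
move=> c0 b0; exists [seq [ffun i => Num.sqrt (c l) * b l i] | l : I].
split=> [_ /mapP[l _ ->] i|i j]; first by rewrite ffunE mulr_ge0 ?sqrtr_ge0.
rewrite big_map big_enum; apply: eq_bigr => l _.
by rewrite !ffunE mulrACA -expr2 sqr_sqrtr.
Qed.

(* The edge k ~ l contributes M k l / (d_k d_l) times the square of
   d_l e_k + d_k e_l, which takes M k l * d_l / d_k away from the entry (k, k). *)
Lemma cp_scaled_dominant M (d : T -> R) : (forall i j, M i j = M j i) ->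
  (forall i j, 0 <= M i j) -> (forall i, 0 < d i) ->
  (forall i, \sum_(j | j != i) M i j * d j <= M i i * d i) ->
  completely_positive M.
Proof.
move=> sM M0 d0 dom.
have dn0 i : d i != 0 by rewrite gt_eqF.
(* Every edge is met both as [(k, l)] and as [(l, k)], whence the division by 2. *)
pose c (p : T * T) := if p.1 == p.2 then 0 else M p.1 p.2 / (d p.1 * d p.2) / 2.
pose b (p : T * T) i := d p.2 * (p.1 == i)%:R + d p.1 * (p.2 == i)%:R.
(* What the edges leave of the diagonal; dominance makes it nonnegative. *)
pose r k := M k k - \sum_(l | l != k) M k l * d l / d k.
have cE k l : c (k, l) = c (l, k) by rewrite /c /= eq_sym sM (mulrC (d k)).
have cpE : completely_positive (fun i j => \sum_p c p * (b p i * b p j)).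
  apply: cp_combination => [[k l]|[k l] i].
    rewrite /c /=; case: ifP => // _.
    by rewrite !divr_ge0 // mulr_ge0 // ltW.
  by rewrite /b addr_ge0 // mulr_ge0 // ?ler0n // ltW.
have cpD : completely_positive (fun i j => \sum_k r k * ((k == i)%:R * (k == j)%:R)).
  apply: cp_combination => [k|k i]; last exact: ler0n.
  rewrite subr_ge0 -(ler_pM2r (d0 k)) mulr_suml.
  by rewrite (eq_bigr (fun l => M k l * d l)) // => l _; rewrite divfK.
apply: cp_eq (cp_add cpE cpD) => i j.
have -> : \sum_k r k * ((k == i)%:R * (k == j)%:R) = r i * (i == j)%:R.
  by under eq_bigr do rewrite mulrCA; rewrite sum_delta.
have -> : \sum_p c p * (b p i * b p j) =
    \sum_k (k == i)%:R * ((k == j)%:R * (\sum_l c (k, l) * d l ^+ 2))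
  + \sum_k (k == i)%:R * (\sum_l (l == j)%:R * (c (k, l) * d l * d k))
  + \sum_l (l == i)%:R * (\sum_k (k == j)%:R * (c (k, l) * d l * d k))
  + \sum_l (l == i)%:R * ((l == j)%:R * (\sum_k c (k, l) * d k ^+ 2)).
  pose S1 k l := (k == i)%:R * ((k == j)%:R * (c (k, l) * d l ^+ 2)).
  pose S2 k l := (k == i)%:R * ((l == j)%:R * (c (k, l) * d l * d k)).
  pose S3 k l := (l == i)%:R * ((k == j)%:R * (c (k, l) * d l * d k)).
  pose S4 k l := (l == i)%:R * ((l == j)%:R * (c (k, l) * d k ^+ 2)).
  transitivity (\sum_k \sum_l (S1 k l + S2 k l + S3 k l + S4 k l)).
    rewrite pair_bigA; apply: eq_bigr => -[k l] _ /=.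
    by rewrite /S1 /S2 /S3 /S4 /b /=; ring.
  under eq_bigr do rewrite !big_split; rewrite !big_split /=.
  congr (_ + _ + _ + _); [| | rewrite exchange_big | rewrite exchange_big];
    by apply: eq_bigr => k _; rewrite !mulr_sumr.
rewrite !sum_delta.
have -> : \sum_k c (k, i) * d k ^+ 2 = \sum_l c (i, l) * d l ^+ 2.
  by apply: eq_bigr => l _; rewrite cE.
have [<-|ij] := eqVneq i j; last first.
  rewrite (cE j i) /c /= (negPf ij); field; rewrite ?dn0 //.
have -> : \sum_l c (i, l) * d l ^+ 2 = (\sum_(l | l != i) M i l * d l / d i) / 2.
  rewrite (bigD1 i) //= {1}/c /= eqxx mul0r add0r mulr_suml.
  apply: eq_bigr => l /negPf il; rewrite /c /= eq_sym il; field.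
  by rewrite ?dn0.
by rewrite /c /= eqxx /r; field.
Qed.

(** Negating the coordinates of one colour reverses the sign of all off-diagonal entries and gives a
    psd Z-matrix [N]. For [d] positive, [N d >= 0] is exactly the dominance condition of
    [cp_scaled_dominant]. *)
Lemma cp_bipartite M (col : T -> bool) : psd M -> (forall i j, 0 <= M i j) ->
  (forall i j, i != j -> M i j != 0 -> col i != col j) ->
  completely_positive M.
Proof.
move=> pM M0 colM; pose sg i : R := (-1) ^+ col i.
have sg2 i : sg i * sg i = 1 by rewrite -signr_addb addbb.
pose N i j := sg i * sg j * M i j.
have NE i j : i != j -> N i j = - M i j.
  move=> ij; have [M00|/(colM _ _ ij)] := eqVneq (M i j) 0.
    by rewrite /N M00 mulr0 oppr0.
  by move=> cij; rewrite /N -signr_addb -negb_eqb cij expr1 mulN1r.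
have pN : psd N.
  split=> [i j|x]; first by rewrite /N pM.1 (mulrC (sg i)).
  have -> : bform N x x = bform M (fun i => sg i * x i) (fun i => sg i * x i).
    by apply: eq_bigr => i _; apply: eq_bigr => j _; rewrite /N; ring.
  exact: pM.2.
have zN i j : i != j -> N i j <= 0 by move=> ij; rewrite NE // oppr_le0.
have [d [d0 dN]] := zmatrix_positive_vector pN zN.
apply: (cp_scaled_dominant pM.1 M0 d0) => i.
have := dN i; rewrite (bigD1 i) //= {1}/N sg2 mul1r.
rewrite (eq_bigr (fun j => - (M i j * d j))) => [|j ji]; last first.
  by rewrite NE 1?eq_sym // mulNr.
by rewrite sumrN subr_ge0.
Qed.

End CompletelyPositive.

(** * Reductions of doubly nonnegative matrices along the support graph *)

Section NoLongOddCycle.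
Variables (R : realType) (T : finType).
Implicit Types (M N : T -> T -> R).

Definition dnn M := psd M /\ forall i j, 0 <= M i j.

Definition support M : rel T := fun i j => (i != j) && (M i j != 0).

(** The multiple [s] is the largest that keeps all entries nonnegative. As the neighbours of [v]
    form a clique, only nonzero entries of [M] are changed, so no edge is created. *)
Lemma dnn_simplicial_reduction M v u : dnn M ->
  simplicial (support M) v -> support M v u ->
  exists s N, [/\ 0 <= s, dnn N, forall i j, M i j = N i j + s * (M v i * M v j),
    subrel (support N) (support M) &
    exists i j, support M i j /\ ~~ support N i j].
Proof.
move=> [pM M0] clq /andP[vu Mvu]; have Mvv := psd_diag_gt0 pM Mvu.
have sM := pM.1.
have clq' i j : i != j -> M v i * M v j != 0 -> M i j != 0.
  rewrite mulf_eq0 negb_or => ij /andP[Mi Mj].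
  have [<-//|vi] := eqVneq v i; have [<-|vj] := eqVneq v j; first by rewrite sM.
  have /andP[] // : support M i j by apply: clq; rewrite // /support ?vi ?vj.
pose P := [pred p : T * T | M v p.1 * M v p.2 != 0].
pose ratio (p : T * T) := M p.1 p.2 / (M v p.1 * M v p.2).
have Pvv : P (v, v) by rewrite /= mulf_neq0 // gt_eqF.
have [[i0 j0] /= P0 min0] := @arg_minP _ R _ (v, v) P ratio Pvv.
set s := ratio (i0, j0) in min0.
have s0 : 0 <= s by rewrite divr_ge0 // mulr_ge0.
(* The pair [(v, v)] competes for the minimum with ratio [1 / M v v], which keeps [s] in the range
   of [psd_schur]. *)
have s1 : s * M v v <= 1.
  have := min0 (v, v) Pvv; rewrite -(ler_pM2r Mvv) => /le_trans; apply.
  by rewrite /ratio /= invfM mulrA divff ?mul1r ?mulVf // gt_eqF.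
pose N i j := M i j - s * (M v i * M v j).
have N0 i j : 0 <= N i j.
  have [x0|xn0] := eqVneq (M v i * M v j) 0; first by rewrite /N x0 mulr0 subr0.
  have x_gt0 : 0 < M v i * M v j by rewrite lt_def xn0 mulr_ge0.
  rewrite subr_ge0 -ler_pdivlMr //; exact: (min0 (i, j)).
exists s, N; split=> //.
- by split=> //; apply: psd_schur.
- by move=> i j; rewrite /N; ring.
- move=> i j /andP[ij]; rewrite /support ij /=.
  apply: contraNneq => Mij; rewrite /N Mij sub0r oppr_eq0 mulf_eq0.
  by apply/orP; right; apply: contraTT isT => /(clq' i j ij); rewrite Mij eqxx.
(* In the case of equality row [v] of [N] is zero and the edge from [v] to [u] disappears. Otherwise
   the minimum is attained off the diagonal, since diagonal ratios are at least [1 / M v v] by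
   [psd_entry_sq]. *)
have [sv|sv] := eqVneq (s * M v v) 1.
  by exists v, u; rewrite /support vu Mvu /N mulrA sv mul1r subrr eqxx.
have ij0 : i0 != j0.
  apply: contra_neq sv => eij; apply/eqP; rewrite eq_le s1 /=.
  rewrite -eij in P0 *; have x_gt0 : 0 < M v i0 * M v i0 by rewrite lt_def P0 mulr_ge0.
  rewrite /s /ratio /= -eij mulrAC ler_pdivlMr // mul1r -expr2 (mulrC (M i0 i0)).
  exact: psd_entry_sq.
exists i0, j0; rewrite /support ij0 clq' //= negbK /N /s /ratio /=; split=> //.
by rewrite divfK // subrr.
Qed.

(** The two sides share only the entry [(v, v)]. The side of [A] receives just enough of it to
    become psd, and gluing test vectors at [v] shows that the remainder suffices for the other
    side. *)
Lemma dnn_cut M v (A : {set T}) : dnn M -> v \notin A ->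
  (forall i j, i \in A -> j \notin A -> j != v -> M i j = 0) ->
  exists N1 N2, [/\ dnn N1, dnn N2, forall i j, M i j = N1 i j + N2 i j &
   forall i j, i != j ->
     if (i \in A) || (j \in A) then N2 i j = 0 else N1 i j = 0].
Proof.
move=> [pM M0] vA MA0; have sM := pM.1.
pose K1 i j := if (i \in A) || (j \in A) then M i j else 0.
pose K2 i j := if (i \in A) || (j \in A) then 0 else M i j.
(* Vectors that agree at [v] combine into one test vector for [M], as [A] is joined to its
   complement through [v] only. *)
have glue x y : x v = y v -> 0 <= bform K1 x x + bform K2 y y.
  move=> xyv; pose z i := if i \in A then x i else y i.
  suff -> : bform K1 x x + bform K2 y y = bform M z z by apply: pM.2.
  rewrite -big_split; apply: eq_bigr => i _; rewrite -big_split.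
  apply: eq_bigr => j _; rewrite /K1 /K2 /z /=.
  case: (boolP (i \in A)) => iA; case: (boolP (j \in A)) => jA /=; try ring.
    have [->|jv] := eqVneq j v; first by rewrite xyv; ring.
    by rewrite (MA0 i j) //; ring.
  have [->|iv] := eqVneq i v; first by rewrite xyv; ring.
  by rewrite sM (MA0 j i) //; ring.
pose S := [set r : R | exists x, x v = 1 /\ r = - bform K1 x x]%classic.
have ubS y : y v = 1 -> (ubound S (bform K2 y y))%classic.
  move=> y1 _ [x [x1 ->]]; rewrite -subr_ge0 opprK addrC glue //.
  by rewrite x1.
have supS : has_sup S.
  split; first by exists (- bform K1 (fun=> 1) (fun=> 1)), (fun=> 1).
  by exists (bform K2 (fun=> 1) (fun=> 1)); apply: ubS.
(* The least entry (v, v) that makes the part on A psd. *)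
pose al := sup S.
have bform_scale K (c : R) x : bform K (fun i => c * x i) (fun i => c * x i)
    = c ^+ 2 * bform K x x.
  rewrite mulr_sumr; apply: eq_bigr => i _; rewrite mulr_sumr.
  by apply: eq_bigr => j _; ring.
have bform0 K : bform K (fun=> 0) (fun=> 0) = 0.
  by apply: big1 => i _; apply: big1 => j _; rewrite !mulr0.
pose N1 i j := K1 i j + al * ((i == v)%:R * (j == v)%:R).
pose N2 i j := K2 i j + - al * ((i == v)%:R * (j == v)%:R).
have bN K a x : bform (fun i j => K i j + a * ((i == v)%:R * (j == v)%:R)) x x
    = bform K x x + a * x v ^+ 2.
  by rewrite bformDM bformZM bform_outer !sum_delta expr2.
have sK1 i j : K1 i j = K1 j i by rewrite /K1 orbC sM.
have sK2 i j : K2 i j = K2 j i by rewrite /K2 orbC sM.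
have pN1 : psd N1.
  split=> [i j|x]; first by rewrite /N1 sK1 (mulrC (_ == _)%:R).
  (* If [x v = 0], [x] is glued to the zero vector; otherwise it is rescaled to [x v = 1]. *)
  rewrite bN; have [x0|x0] := eqVneq (x v) 0.
    by have := glue x (fun=> 0) x0; rewrite bform0 addr0 x0 expr0n mulr0 addr0.
  have x2 : 0 < x v ^+ 2 by rewrite exprn_even_gt0.
  have : - bform K1 (fun i => (x v)^-1 * x i) (fun i => (x v)^-1 * x i) <= al.
    apply: sup_upper_bound => //; exists (fun i => (x v)^-1 * x i).
    by rewrite mulVf.
  by rewrite bform_scale exprVn lerNl ler_pdivlMl // mulrN -subr_ge0 opprK [_ * al]mulrC.
have pN2 : psd N2.
  split=> [i j|x]; first by rewrite /N2 sK2 (mulrC (_ == _)%:R).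
  rewrite bN; have [x0|x0] := eqVneq (x v) 0.
    have := glue (fun=> 0) x (esym x0).
    by rewrite bform0 add0r x0 expr0n mulr0 addr0.
  have x2 : 0 < x v ^+ 2 by rewrite exprn_even_gt0.
  have : al <= bform K2 (fun i => (x v)^-1 * x i) (fun i => (x v)^-1 * x i).
    by apply: ge_sup; [case: supS|apply: ubS; rewrite mulVf].
  by rewrite bform_scale exprVn ler_pdivlMl // mulNr subr_ge0 [_ * al]mulrC.
have NvE a i j : i != j -> a * ((i == v)%:R * (j == v)%:R) = 0 :> R.
  move=> ij; rewrite -natrM mulnb; case: andP => [[/eqP iv /eqP jv]|_].
    by rewrite iv jv eqxx in ij.
  by rewrite mulr0.
exists N1, N2; split.
- split=> // i j; have [->|ij] := eqVneq i j; first exact: psd_diag_ge0.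
  by rewrite /N1 NvE // addr0 /K1; case: ifP.
- split=> // i j; have [->|ij] := eqVneq i j; first exact: psd_diag_ge0.
  by rewrite /N2 NvE // addr0 /K2; case: ifP.
- by move=> i j; rewrite /N1 /N2 /K1 /K2; case: ifP => _; ring.
- by move=> i j ij; rewrite /N1 /N2 !NvE // !addr0 /K1 /K2; case: (_ || _).
Qed.

Theorem dnn_completely_positive M : dnn M ->
  (forall s, uniq s -> cycle (support M) s -> odd (size s) -> (size s < 5)%N) ->
  completely_positive M.
Proof.
pose edges N := [set p : T * T | support N p.1 p.2].
have [n] := ubnP #|edges M|; elim: n M => // n IHn M; rewrite ltnS => leMn dM nolong.
have IH N : dnn N -> subrel (support N) (support M) ->
    (exists i j, support M i j /\ ~~ support N i j) -> completely_positive N.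
  move=> dN sNM [i [j [Mij Nij]]]; apply: IHn => //.
    apply: leq_trans leMn; apply/proper_card/properP; split.
      by apply/subsetP => -[k l]; rewrite !inE; apply: sNM.
    by exists (i, j); rewrite !inE.
  move=> s us cs; apply: nolong us _.
  by case: s cs => //= x s; apply: sub_path.
have sym i j : support M i j = support M j i.
  by rewrite /support eq_sym dM.1.1.
have irr i : ~~ support M i i by rewrite /support eqxx.
have [[col colP]|[v [u [sv vu]]]|
      [v [A [vA cutA [i1 [j1 [iA1 ij1]]] [i2 [j2 [iA2 jA2 ij2]]]]]]] :=
    graph_reduction sym irr nolong.
- apply: (cp_bipartite (col := col)) dM.1 dM.2 _ => i j ij Mij.
  by apply: colP; rewrite /support ij.
- have [s [N [s0 dN MN sNM lost]]] := dnn_simplicial_reduction dM sv vu.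
  have cN := IH N dN sNM lost.
  have cx := @cp_combination R T unit (fun=> s) (fun=> M v) (fun=> s0) (fun=> dM.2 v).
  apply: cp_eq (cp_add cN cx) => i j; rewrite [RHS]MN.
  by rewrite (big_pred1 tt) // => -[].
have MA0 i j : i \in A -> j \notin A -> j != v -> M i j = 0.
  move=> iA jA jv; have := cutA i j iA jA jv.
  rewrite /support negb_and !negbK => /orP[/eqP ij|/eqP//].
  by rewrite ij (negPf jA) in iA.
have [N1 [N2 [d1 d2 MN N12]]] := dnn_cut dM vA MA0.
(* [N1] keeps the edges that meet [A] and [N2] the others, so each misses an edge supplied by
   [cut]. *)
have c1 : completely_positive N1.
  apply: IH d1 _ _ => [i j /andP[ij]|].
    rewrite /support ij /= MN; have := N12 i j ij; case: ifP => _ ->.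
      by rewrite addr0.
    by rewrite eqxx.
  exists i2, j2; split=> //; have i2j2 : i2 != j2 by case/andP: ij2.
  by have := N12 _ _ i2j2; rewrite (negPf iA2) (negPf jA2) /support => ->; rewrite eqxx andbF.
have c2 : completely_positive N2.
  apply: IH d2 _ _ => [i j /andP[ij]|].
    rewrite /support ij /= MN; have := N12 i j ij; case: ifP => _ ->.
      by rewrite eqxx.
    by rewrite add0r.
  exists i1, j1; split=> //; have i1j1 : i1 != j1 by case/andP: ij1.
  by have := N12 _ _ i1j1; rewrite iA1 /support => ->; rewrite eqxx andbF.
by apply: cp_eq (cp_add c1 c2) => i j; rewrite MN.
Qed.

End NoLongOddCycle.

(** * The robust inequality for cycles *)

Local Open Scope sesquilinear_scope.

Section RobustCycleInequality.
Variables (C : numClosedFieldType) (d : nat).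
Implicit Types (A B P Q E : 'M[C]_d).

(** The squared Hilbert-Schmidt norm. *)
Definition hs A := \tr (A^t* *m A).

Definition mxpsd P := P^t* = P /\ forall v : 'cV[C]_d, 0 <= (v^t* *m P *m v) 0 0.

Lemma adjM A B : (A *m B)^t* = B^t* *m A^t*.
Proof. by rewrite trmx_mul map_mxM. Qed.

Lemma adjB A B : (A - B)^t* = A^t* - B^t*.
Proof. by rewrite linearB map_mxB. Qed.

Lemma adj1 : (1%:M : 'M[C]_d)^t* = 1%:M.
Proof. by rewrite tr_scalar_mx map_scalar_mx rmorph1. Qed.

Lemma tr_adj A : \tr (A^t*) = (\tr A)^*.
Proof. by rewrite rmorph_sum; apply: eq_bigr => i _; rewrite !mxE. Qed.

Lemma hs_ge0 A : 0 <= hs A.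
Proof.
apply: sumr_ge0 => i _; rewrite mxE; apply: sumr_ge0 => j _.
by rewrite !mxE mulrC mul_conjC_ge0.
Qed.

Lemma hs_adj A : hs (A^t*) = hs A.
Proof. by rewrite /hs trmxCK mxtrace_mulC. Qed.

(** Expansion of [0 <= hs (t *: A^t* - B)]; the trace and its conjugate add up to twice the real
    part. *)
Lemma hs_amgm A B (t : C) : 0 <= t ->
  t * (\tr (A *m B) + (\tr (A *m B))^*) <= t ^+ 2 * hs A + hs B.
Proof.
move=> t0; have := hs_ge0 (t *: A^t* - B).
have tR : t^* = t by apply: conj_Creal; rewrite ger0_real.
have -> : hs (t *: A^t* - B) = t ^+ 2 * hs (A^t*) + hs B
    - t * (\tr (A *m B) + (\tr (A *m B))^*).
  rewrite -tr_adj /hs adjB adjM.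
  have -> : (t *: A^t*)^t* = t *: A.
    by rewrite linearZ map_mxZ /= tR trmxCK.
  rewrite mulmxBl !mulmxBr -!scalemxAl -!scalemxAr trmxCK !raddfB /= !mxtraceZ; ring.
by rewrite subr_ge0 hs_adj.
Qed.

(** For Hermitian [A], the spectral projection for the eigenvalues [>= 0], zero included. *)
Definition pos_proj A : 'M[C]_d :=
  let U := spectralmx A in
  U^t* *m diag_mx (\row_k (0 <= spectral_diag A 0 k)%R%:R) *m U.

Lemma hs_proj_split E A : E^t* = E -> E *m E = E ->
  hs A = hs (E *m A) + hs ((1%:M - E) *m A).
Proof.
move=> hE iE; have iF : (1%:M - E) *m (1%:M - E) = 1%:M - E.
  by rewrite mulmxBl !mulmxBr !mul1mx mulmx1 iE subrr subr0.
rewrite /hs !adjM adjB adj1 hE -!mulmxA (mulmxA E E) (mulmxA (1%:M - E)) iE iF.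
by rewrite -raddfD /= -mulmxDr -mulmxDl addrC subrK mul1mx.
Qed.

Lemma tr_psd_unitary_diag P (U : 'M[C]_d) (r : 'rV[C]_d) : mxpsd P ->
  (forall k, 0 <= r 0 k) -> 0 <= \tr (P *m (U^t* *m diag_mx r *m U)).
Proof.
move=> [_ pP] r0; rewrite !mulmxA mxtrace_mulC !mulmxA.
apply: sumr_ge0 => k _; rewrite mul_mx_diag mxE; apply: mulr_ge0 => //.
have := pP ((row k U)^t*); rewrite trmxCK => /le_trans; apply.
rewrite le_eqVlt; apply/orP; left; apply/eqP.
rewrite -row_mul !mxE; apply: eq_bigr => j _; rewrite !mxE.
by [].
Qed.

(** All matrices built from [A] are diagonal in its eigenbasis [U]: [E *m A] keeps the nonnegative
    eigenvalues and [(1 - E) *m A] the negative ones, and their traces against psd matrices have the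
    corresponding signs. *)
Lemma pos_projP A : A^t* = A -> let E := pos_proj A in
  [/\ E^t* = E, E *m E = E, E *m A = A *m E &
   forall P, mxpsd P -> 0 <= \tr (P *m (E *m A)) /\
                        \tr (P *m ((1%:M - E) *m A)) <= 0].
Proof.
move=> hA; set U := spectralmx A; set D := spectral_diag A.
have UU : U *m U^t* = 1%:M by apply/unitarymxP/spectral_unitarymx.
have UU' : U^t* *m U = 1%:M by apply: mulmx1C.
have hA' : A \is hermsymmx.
  by apply/is_hermitianmxP; rewrite expr0 scale1r hA.
have AE : A = U^t* *m diag_mx D *m U.
  have /orthomx_spectralP := hermitian_normalmx hA'.
  by rewrite invmx_unitary ?spectral_unitarymx.
have Dreal k : D 0 k \is Num.real.
  by have /mxOverP/(_ 0 k) := hermitian_spectral_diag_real hA'.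
have conjUM (r s : 'rV[C]_d) : (U^t* *m diag_mx r *m U) *m (U^t* *m diag_mx s *m U)
    = U^t* *m diag_mx (\row_k (r 0 k * s 0 k)) *m U.
  rewrite !mulmxA -(mulmxA _ U) UU mulmx1 -(mulmxA _ (diag_mx r)); congr (_ *m _ *m _).
  by rewrite mulmx_diag.
pose chi : 'rV[C]_d := \row_k (0 <= D 0 k)%R%:R.
have EE : pos_proj A = U^t* *m diag_mx chi *m U by [].
have eqd (r s : 'rV[C]_d) : (forall k, r 0 k = s 0 k) ->
    U^t* *m diag_mx r *m U = U^t* *m diag_mx s *m U.
  by move=> e; congr (_ *m diag_mx _ *m _); apply/rowP => k; apply: e.
have EA : pos_proj A *m A = U^t* *m diag_mx (\row_k (chi 0 k * D 0 k)) *m U.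
  by rewrite EE AE conjUM.
have FA : (1%:M - pos_proj A) *m A
    = U^t* *m diag_mx (\row_k ((1 - chi 0 k) * D 0 k)) *m U.
  rewrite mulmxBl mul1mx EA AE -mulmxBl -mulmxBr -linearB /=.
  by apply: eqd => k; rewrite !mxE; ring.
split.
- rewrite EE !adjM trmxCK -mulmxA; congr (_ *m (_ *m _)).
  rewrite tr_diag_mx map_diag_mx; congr diag_mx; apply/rowP => k.
  by rewrite !mxE; exact: conjC_nat.
- rewrite EE conjUM; apply: eqd => k; rewrite !mxE.
  by case: (_ <= _); rewrite ?mulr1 ?mulr0.
- by rewrite EA EE AE conjUM; apply: eqd => k; rewrite !mxE mulrC.
- move=> P pP; split.
    rewrite EA; apply: tr_psd_unitary_diag => // k; rewrite !mxE.
    by case: (boolP (0 <= D 0 k)) => Dk; rewrite ?mul1r ?mul0r.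
  pose r : 'rV[C]_d := \row_k (- ((1 - chi 0 k) * D 0 k)).
  have -> : (1%:M - pos_proj A) *m A = - (U^t* *m diag_mx r *m U).
    by rewrite FA -mulNmx -mulmxN -linearN; apply: eqd => k; rewrite !mxE opprK.
  rewrite mulmxN linearN oppr_le0.
  apply: tr_psd_unitary_diag => // k; rewrite !mxE.
  case: (real_ge0P (Dreal k)) => Dk; first by rewrite subrr mul0r oppr0.
  by rewrite subr0 mul1r oppr_ge0 ltW.
Qed.

(* For P - Q = A, both P - A+ and Q - A- equal the same D, whose square norm is
   at most tr (P Q); the two projected matrices are the two parts of D. *)
Lemma pos_proj_bound P Q : mxpsd P -> mxpsd Q ->
  hs ((1%:M - pos_proj (P - Q)) *m P) + hs (pos_proj (P - Q) *m Q) <= \tr (P *m Q).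
Proof.
move=> pP pQ; set E := pos_proj (P - Q); have hA : (P - Q)^t* = P - Q by rewrite adjB pP.1 pQ.1.
have [hE iE cE trE] := pos_projP hA; rewrite -/E in hE iE cE trE.
set A := P - Q in hA cE trE.
have EF : E *m (1%:M - E) = 0 by rewrite mulmxBr mulmx1 iE subrr.
have FE : (1%:M - E) *m E = 0 by rewrite mulmxBl mul1mx iE subrr.
pose D := P - E *m A.
have DQ : D = Q + (1%:M - E) *m A.
  by rewrite /D mulmxBl mul1mx addrA /A [Q + _]addrC subrK.
have hD : D^t* = D by rewrite /D adjB adjM hE hA pP.1 cE.
have -> : (1%:M - E) *m P = (1%:M - E) *m D.
  by rewrite /D mulmxBr mulmxA FE mul0mx subr0.
have -> : E *m Q = E *m D by rewrite DQ mulmxDr mulmxA EF mul0mx addr0.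
(* One factor [D] is written as [P - E *m A], the other as [Q + (1 - E) *m A]. The product of the
   two corrections is zero, and each remaining correction can only lower the trace. *)
rewrite addrC -hs_proj_split // /hs hD {2}DQ /D mulmxBl (mulmxDr P) (mulmxDr (E *m A)).
have -> : E *m A *m ((1%:M - E) *m A) = 0.
  by rewrite cE mulmxA -(mulmxA A) EF mulmx0 mul0mx.
rewrite addr0 raddfB raddfD /= (mxtrace_mulC (E *m A)).
have [t1 _] := trE Q pQ; have [_ t2] := trE P pP.
by rewrite -addrA gerDl subr_le0 (le_trans t2).
Qed.

(** The projections split the trace into a main term, bounded by AM-GM, and two terms that contain,
    up to adjoints, the small factor [E' *m P] or [(1 - E) *m Q]. AM-GM with weight [eta] bounds
    twice the real part of each of these by [3 * eta]. *)
Lemma edge_bound E E' P Q (eta : C) : 0 < eta ->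
  E^t* = E -> E *m E = E -> E'^t* = E' -> E' *m E' = E' -> P^t* = P -> Q^t* = Q ->
  hs P <= 2 -> hs Q <= 2 ->
  hs ((1%:M - E) *m Q) <= eta ^+ 2 -> hs (E' *m P) <= eta ^+ 2 ->
  2 * \tr (P *m Q) <= hs (E *m P) + hs ((1%:M - E') *m Q) + 6 * eta.
Proof.
move=> eta0 hE iE hE' iE' hP hQ P2 Q2 FQ EP.
have small A B : hs A <= 2 -> hs B <= eta ^+ 2 ->
    \tr (A *m B) + (\tr (A *m B))^* <= 3 * eta.
  move=> A2 B2; rewrite -(ler_pM2l eta0); apply: le_trans (hs_amgm A B (ltW eta0)) _.
  have -> : eta * (3 * eta) = eta ^+ 2 * 2 + eta ^+ 2 by ring.
  by rewrite lerD // ler_wpM2l // exprn_ge0 // ltW.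
set F := 1%:M - E in FQ *; set F' := 1%:M - E'.
have hF : F^t* = F by rewrite adjB adj1 hE.
have e1 : \tr (P *m Q) = \tr ((E *m P) *m (F' *m Q)) + \tr ((Q *m E) *m (P *m E'))
    + \tr (P *m (Q *m F)).
  rewrite (mxtrace_mulC (Q *m E)) -!mulmxA.
  rewrite [X in _ + X + _](_ : _ = \tr (E *m (P *m (E' *m Q)))); last first.
    by rewrite [RHS]mxtrace_mulC !mulmxA.
  rewrite [X in _ + X](_ : _ = \tr (F *m (P *m Q))); last first.
    by rewrite [RHS]mxtrace_mulC mulmxA.
  by rewrite /F /F' !(mulmxBl, mul1mx, mulmxBr) !raddfB /=; ring.
have e2 : 2 * \tr (P *m Q) = \tr (P *m Q) + (\tr (P *m Q))^*.
  by rewrite -tr_adj adjM hP hQ (mxtrace_mulC Q) mulr_natl mulr2n.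
have b1 := hs_amgm (E *m P) (F' *m Q) ler01.
rewrite !mul1r expr1n mul1r in b1.
have b2 : \tr (P *m (Q *m F)) + (\tr (P *m (Q *m F)))^* <= 3 * eta.
  by apply: small; rewrite // -hs_adj adjM hF hQ.
have b3 : \tr ((Q *m E) *m (P *m E')) + (\tr ((Q *m E) *m (P *m E')))^* <= 3 * eta.
  apply: small; last by rewrite -hs_adj adjM hE' hP.
  rewrite -hs_adj adjM hE hQ; apply: le_trans Q2.
  by rewrite (hs_proj_split Q hE iE) lerDl hs_ge0.
rewrite e2 e1 !rmorphD /=.
have -> : 6 * eta = 3 * eta + 3 * eta by ring.
apply: le_trans (lerD b1 (lerD b3 b2)).
by rewrite le_eqVlt; apply/orP; left; apply/eqP; ring.
Qed.

(** [E i] divides the norm of [P (next i)] between its two edges: the part under [E i] goes to the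
    following edge, the part under [1 - E i] to the preceding one. *)
Theorem robust_cycle_inequality (I : finType) (next : I -> I) (P : I -> 'M[C]_d)
    (eta : C) : injective next -> 0 < eta -> (forall i, mxpsd (P i)) ->
  (forall i, \tr (P i *m P i) <= 2) ->
  (forall i, \tr (P (next (next i)) *m P i) <= eta ^+ 2) ->
  \sum_i 2 * \tr (P i *m P (next i)) <= \sum_i (\tr (P i *m P i) + 6 * eta).
Proof.
move=> inj eta0 pP P2 far; pose E i := pos_proj (P (next (next i)) - P i).
have hsP i : hs (P i) = \tr (P i *m P i) by rewrite /hs (pP i).1.
have bound i := pos_proj_bound (pP (next (next i))) (pP i).
have [hE iE] : (forall i, (E i)^t* = E i) /\ (forall i, E i *m E i = E i).
  by split=> i; have [] := @pos_projP (P (next (next i)) - P i) _;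
    rewrite // adjB !(pP _).1.
have b1 i : hs ((1%:M - E i) *m P (next (next i))) <= eta ^+ 2.
  apply: le_trans (far i); apply: le_trans (bound i).
  by rewrite lerDl hs_ge0.
have b2 i : hs (E i *m P i) <= eta ^+ 2.
  apply: le_trans (far i); apply: le_trans (bound i).
  by rewrite lerDr hs_ge0.
rewrite (reindex_inj inj) /=.
(* The shares are regrouped by edge instead of by vertex, which shifts one of the two families by
   [next]. *)
have -> : \sum_i (\tr (P i *m P i) + 6 * eta) =
   \sum_i (hs (E i *m P (next i)) + hs ((1%:M - E (next i)) *m P (next (next i))) + 6 * eta).
  rewrite !big_split /=; congr (_ + _).
  pose h i := hs ((1%:M - E i) *m P (next i)).
  rewrite [in LHS](reindex_inj inj) -(@reindex_inj _ _ _ _ next xpredT h inj).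
  by rewrite -big_split; apply: eq_bigr => i _ /=; rewrite -hs_proj_split // hsP.
apply: ler_sum => i _; apply: edge_bound => //; rewrite ?hsP ?(pP _).1 //.
Qed.

End RobustCycleInequality.

(** * A doubly nonnegative matrix that is not cpsd *)

Section OddCycleMatrix.
Variables (R : realFieldType) (I T : finType) (next : I -> I) (f : I -> T).
Variables (k : nat) (G : rel T).
Hypotheses (next_inj : injective next) (f_inj : injective f).
Hypotheses (odd_k : odd k) (next_k : forall i, iter k next i = i).

(** If every [x i + x (next i)] is small, values nearly change sign at each step. After the odd
    number [k] of steps [x i] is close to [- x i], hence small. *)
Lemma odd_cycle_coercive : exists dl : R, [/\ 0 < dl, dl <= 1 &
  forall x : I -> R,
    2 * dl * \sum_i x i ^+ 2 <= \sum_i (x i + x (next i)) ^+ 2].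
Proof.
(* Each of the [k] steps costs a factor of at most 4, and the sum over [i] costs [#|I|]; the
   successor is at least 1 even for empty [I]. *)
exists ((#|I|.+1)%:R * 4 ^+ k)^-1.
have p4 : 1 <= 4 ^+ k :> R by rewrite exprn_ege1 // ler1n.
have pI : 1 <= (#|I|.+1)%:R :> R by rewrite ler1n.
have p0 : 0 < (#|I|.+1)%:R * 4 ^+ k :> R.
  by rewrite mulr_gt0 // (lt_le_trans ltr01).
split=> [||x]; first by rewrite invr_gt0.
  by rewrite invf_le1 // mulr_ege1.
set Q := (X in _ <= X).
have Qi i : (x i + x (next i)) ^+ 2 <= Q.
  by rewrite /Q (bigD1 i) //= lerDl sumr_ge0 // => j _; apply: sqr_ge0.
have Q0 : 0 <= Q by apply: sumr_ge0 => j _; apply: sqr_ge0.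
have step m i : (x (iter m next i) - (-1) ^+ m * x i) ^+ 2 <= 4 ^+ m * Q.
  elim: m => [|m IHm] /=; first by rewrite !expr0 !mul1r subrr expr0n.
  have e : forall a b : R, (a - b) ^+ 2 <= 2 * a ^+ 2 + 2 * b ^+ 2.
    by move=> a b; have := sqr_ge0 (a + b); lra.
  set y := iter m next i in IHm *.
  have -> : x (next y) - (-1) ^+ m.+1 * x i =
      (x y + x (next y)) - (x y - (-1) ^+ m * x i) by rewrite exprS; ring.
  apply: le_trans (e _ _) _; have := Qi y.
  have : Q <= 4 ^+ m * Q by rewrite ler_peMl // exprn_ege1 // ler1n.
  by rewrite (exprS 4); lra.
have xQ i : 4 * x i ^+ 2 <= 4 ^+ k * Q.
  have := step k i; rewrite next_k -signr_odd odd_k expr1.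
  by congr (_ <= _); ring.
have sQ : 4 * \sum_i x i ^+ 2 <= #|I|%:R * (4 ^+ k * Q).
  rewrite mulr_sumr; apply: le_trans (ler_sum _ (fun i _ => xQ i)) _.
  by rewrite sumr_const mulr_natl.
rewrite mulrAC -ler_pdivlMr ?invr_gt0 // invrK.
have Q4 : 0 <= 4 ^+ k * Q by rewrite mulr_ge0 // (le_trans ler01).
have : 0 <= #|I|%:R * (4 ^+ k * Q) by rewrite mulr_ge0.
by move: sQ Q4; rewrite -(natr1 #|I|); lra.
Qed.

Hypotheses (next1 : forall i, next i != i) (next2 : forall i, next (next i) != i)
  (next3 : forall i, next (next (next i)) != i).
Hypotheses (Gsym : forall u v, G u v = G v u) (Girr : forall u, ~~ G u u).
Hypothesis Gcycle : forall i, G (f i) (f (next i)).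

Lemma bform_sum (J : finType) (K : J -> T -> T -> R) x y :
  bform (fun u v => \sum_j K j u v) x y = \sum_j bform (K j) x y.
Proof.
rewrite /bform [RHS]exchange_big; apply: eq_bigr => u _.
rewrite [RHS]exchange_big; apply: eq_bigr => v _.
by rewrite mulr_sumr mulr_suml.
Qed.

Lemma odd_cycle_dnn : exists dl : R, [/\ 0 < dl, dl <= 1 &
  forall ep : R, 0 < ep -> ep * #|T|%:R <= dl ->
  exists M : T -> T -> R,
    [/\ psd M, (forall u v, 0 <= M u v) /\
        (forall u v, (u != v) && (M u v != 0) = G u v),
        forall i, 1 <= M (f i) (f (next i)),
        forall i, M (f i) (f i) = 2 - dl &
        forall i, M (f (next (next i))) (f i) <= ep]].
Proof.
have [dl [dl0 dl1 coer]] := odd_cycle_coercive; exists dl; split=> // ep ep0 epT.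
pose e i u : R := (u == f i)%:R.
pose b i u : R := e i u + e (next i) u.
(* On the cycle the diagonal is [2 - (1 + dl) + 1]. The identity covers all of [T], so that indices
   off the cycle can absorb the term in [ep] too. *)
pose M u v : R := \sum_i b i u * b i v + - (1 + dl) * (\sum_i e i u * e i v)
   + ((u == v)%:R + ep * (G u v)%:R).
have e0 i u : 0 <= e i u by apply: ler0n.
have b0 i u : 0 <= b i u by apply: addr_ge0.
have sM u v : M u v = M v u.
  rewrite /M (eq_sym u) Gsym; congr (_ + _ * _ + _);
  by apply: eq_bigr => i _; rewrite mulrC.
have se x i : \sum_u e i u * x u = x (f i) by apply: sum_delta.
have sb x i : \sum_u b i u * x u = x (f i) + x (f (next i)).
  rewrite -(se x i) -(se x (next i)) -big_split.
  by apply: eq_bigr => u _; apply: mulrDl.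
have pM : psd M.
  split=> // x.
  have -> : bform M x x = \sum_i (x (f i) + x (f (next i))) ^+ 2
     - (1 + dl) * (\sum_i x (f i) ^+ 2)
     + (\sum_u x u ^+ 2 + ep * bform (fun u v => (G u v)%:R) x x).
    rewrite /M !bformDM !bformZM !bform_sum mulNr; congr (_ - _ * _ + (_ + _)).
    - by apply: eq_bigr => i _; rewrite bform_outer !sb expr2.
    - by apply: eq_bigr => i _; rewrite bform_outer !se expr2.
    - apply: eq_bigr => u _; rewrite [RHS]expr2 -(sum_delta u (fun v => x u * x v)).
      by apply: eq_bigr => v _; rewrite eq_sym; ring.
  have := coer (fun i => x (f i)).
  set N1 := \sum_i x (f i) ^+ 2; set Q := \sum_i (_ + _) ^+ 2; set N := \sum_u _.
  have N0 : 0 <= N1 by apply: sumr_ge0 => i _; apply: sqr_ge0.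
  have leN : N1 <= N.
    rewrite /N (bigID (mem (f @: setT))) /= big_imset => [/=|i j _ _ /f_inj//].
    rewrite (eq_bigl xpredT) => [|i]; last by rewrite inE.
    by rewrite lerDl sumr_ge0 // => u _; apply: sqr_ge0.
  (* This is [- 2 * x u * x v <= x u ^+ 2 + x v ^+ 2], summed over all pairs. *)
  have GN : - (#|T|%:R * N) <= bform (fun u v => (G u v)%:R) x x.
    have SN : \sum_u \sum_v (x u ^+ 2 + x v ^+ 2) = 2 * (#|T|%:R * N).
      under eq_bigr do rewrite big_split sumr_const /=.
      by rewrite big_split sumr_const /= sumrMnl -/N -[N *+ _]mulr_natl; ring.
    suff : 0 <= 2 * bform (fun u v => (G u v)%:R) x x + 2 * (#|T|%:R * N) by lra.
    rewrite -SN mulr_sumr -big_split; apply: sumr_ge0 => u _ /=.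
    rewrite mulr_sumr -big_split; apply: sumr_ge0 => v _ /=.
    by case: (G u v); rewrite ?mulr1 ?mulr0 ?mul0r;
      have := sqr_ge0 (x u + x v); have := sqr_ge0 (x u); have := sqr_ge0 (x v); lra.
  have epN : ep * #|T|%:R * N <= dl * N.
    by rewrite ler_wpM2r // (le_trans N0).
  have := ler_wpM2l (ltW ep0) GN; rewrite mulrN mulrA.
  (* As [Q >= 2 * dl * N1] and the term in [ep] is at least [- dl * N], this product is a lower
     bound of the form. *)
  have : 0 <= (N - N1) * (1 - dl) by rewrite mulr_ge0 // subr_ge0.
  by lra.
have off u v : u != v -> M u v = \sum_i b i u * b i v + ep * (G u v)%:R.
  move=> uv; rewrite /M (negPf uv) add0r [X in _ * X]big1 ?mulr0 ?addr0 // => i _.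
  rewrite /e -natrM mulnb; case: andP => // -[/eqP ui /eqP vi].
  by rewrite ui vi eqxx in uv.
have sbb0 u v : 0 <= \sum_i b i u * b i v.
  by apply: sumr_ge0 => i _; apply: mulr_ge0.
have Mnonneg u v : 0 <= M u v.
  have [->|uv] := eqVneq u v; first exact: psd_diag_ge0.
  by rewrite off // addr_ge0 // mulr_ge0 ?ler0n // ltW.
have fi i j : (f i == f j) = (i == j) by apply: inj_eq.
have ni i j : (next i == next j) = (i == j) by apply: inj_eq.
exists M; split=> //.
- split=> // u v; have [<-|uv] := eqVneq u v; first by rewrite (negPf (Girr u)).
  rewrite off //=; case Guv: (G u v).
    by rewrite mulr1 gt_eqF // ltr_wpDl.
  rewrite mulr0 addr0 big1 ?eqxx // => i _; apply/eqP; rewrite mulf_eq0.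
  rewrite /b /e.
  have edge (c c' : T) : u = c -> v = c' -> (c == c') || G c c' -> false.
    by move=> <- <-; rewrite (negPf uv) Guv.
  have Gi := Gcycle i; have Gi' : G (f (next i)) (f i) by rewrite Gsym.
  have [ui|ui] := eqVneq u (f i); have [un|un] := eqVneq u (f (next i));
    rewrite ?addr0 ?eqxx // orbC;
    have [vi|vi] := eqVneq v (f i); have [vn|vn] := eqVneq v (f (next i));
    rewrite ?addr0 ?eqxx //;
    solve [by have := edge _ _ ui vi; rewrite ?eqxx ?Gi ?Gi' ?orbT => /(_ isT)
      | by have := edge _ _ ui vn; rewrite ?eqxx ?Gi ?Gi' ?orbT => /(_ isT)
      | by have := edge _ _ un vi; rewrite ?eqxx ?Gi ?Gi' ?orbT => /(_ isT)
      | by have := edge _ _ un vn; rewrite ?eqxx ?Gi ?Gi' ?orbT => /(_ isT)].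
- move=> i; rewrite off; last by rewrite fi eq_sym.
  apply: ler_wpDr; first by rewrite mulr_ge0 ?ler0n // ltW.
  rewrite (bigD1 i) //= ler_wpDr //.
    by apply: sumr_ge0 => j _; apply: mulr_ge0.
  rewrite /b /e !fi eqxx (negPf (next1 i)) eqxx add0r mulr1 eq_sym.
  by rewrite lerDl ler0n.
- move=> i; rewrite /M eqxx (negPf (Girr _)) mulr0 addr0.
  have -> : \sum_l e l (f i) * e l (f i) = 1.
    rewrite -(sum_delta i (fun=> 1)); apply: eq_bigr => l _.
    by rewrite /e fi eq_sym -natrM mulnb andbb mulr1.
  have -> : \sum_l b l (f i) * b l (f i) = 2.
    have -> : 2 = \sum_l (l == i)%:R * 1 + \sum_l (l == i)%:R * 1 :> R.
      by rewrite sum_delta.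
    rewrite [X in _ = _ + X](reindex_inj next_inj) -big_split.
    apply: eq_bigr => l _; rewrite /b /e !fi !(eq_sym i) !mulr1 /=.
    have [->|li] := eqVneq l i; first by rewrite (negPf (next1 i)) mulr0n !addr0 mulr1.
    by rewrite mulr0n !add0r -natrM mulnb andbb.
  by rewrite mulr1n; ring.
move=> i; rewrite off ?fi ?next2 //.
(* No cycle edge contains both [i] and [next (next i)], since [next] would then return to its start
   within three steps. *)
rewrite big1 ?add0r => [|l _].
  by case: (G _ _); rewrite ?mulr1 ?mulr0 // ltW.
rewrite /b /e !fi !ni; apply/eqP; rewrite mulf_eq0.
have [il|il] := eqVneq i l.
  by rewrite -il (negPf (next2 i)) (negPf (next1 i)) addr0 eqxx.
have [inl|inl] := eqVneq i (next l); last by rewrite addr0 eqxx orbT.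
by rewrite inl (negPf (next3 l)) (negPf (next2 l)) addr0 eqxx.
Qed.

End OddCycleMatrix.

(** * Translation to the cpsd definitions, and odd cycles as obstructions *)

Section CpsdMatrices.
Variable R : realType.
Implicit Types n d k : nat.

Lemma quadratic_formE n (X : 'M[R]_n) (v : 'cV[R]_n) :
  (v^T *m X *m v) 0 0 = bform (fun i j => X i j) (fun i => v i 0) (fun i => v i 0).
Proof.
rewrite mxE /bform exchange_big; apply: eq_bigr => j _.
by rewrite mxE mulr_suml; apply: eq_bigr => i _; rewrite !mxE.
Qed.

Lemma psd_realP n (X : 'M[R]_n) : psd_real X <-> psd (fun i j => X i j).
Proof.
split=> [[tX pX]|[sX pX]]; split=> [|v].
- by move=> i j; rewrite -[in LHS]tX mxE.
- have := pX (\col_i v i); rewrite quadratic_formE.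
  by congr (_ <= _); apply: eq_bigr => i _; apply: eq_bigr => j _; rewrite !mxE.
- by apply/matrixP => i j; rewrite mxE.
- by rewrite quadratic_formE.
Qed.

Lemma adjmxE m p (A : 'M[R[i]]_(m, p)) : adjmx A = A^t*.
Proof. by rewrite /adjmx -map_trmx. Qed.

(** The coordinates at [i] of all vectors, put on a diagonal, form the matrix for [i]. One more
    position, holding the default vector 0, keeps the size positive when [s] is empty. *)
Lemma cp_cpsd n (X : 'M[R]_n) : completely_positive (fun i j => X i j) -> cpsd X.
Proof.
move=> [s [s0 XE]].
pose a (i : 'I_n) (l : 'I_(size s).+1) : R := (nth [ffun=> 0] s l) i.
have a0 i l : 0 <= a i l.
  have [ls|sl] := ltnP l (size s); first by apply: s0; apply: mem_nth.
  by rewrite /a nth_default // ffunE.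
pose D i : 'M[R[i]]_((size s).+1) := diag_mx (\row_l ((a i l)%:C)%C).
have aC0 i l : 0 <= ((a i l)%:C)%C :> R[i] by rewrite lecR.
exists (size s).+1, D; split=> //; split=> [i|i j].
  split.
    rewrite adjmxE tr_diag_mx map_diag_mx; congr diag_mx; apply/rowP => l.
    by rewrite !mxE; apply/CrealP; rewrite ger0_real.
  move=> v; rewrite mxE sumr_ge0 // => l _.
  rewrite mul_mx_diag !mxE mulrAC mulr_ge0 //.
  by rewrite mulrC mul_conjC_ge0.
rewrite XE mulmx_diag mxtrace_diag (big_nth [ffun=> 0]) big_mkord.
rewrite big_ord_recr /= [X in _ + X]mxE.
have amax i' : a i' ord_max = 0 by rewrite /a /= nth_default // ffunE.
rewrite !mxE amax rmorph0 mul0r addr0.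
rewrite rmorph_sum; apply: eq_bigr => l _.
by rewrite !mxE -rmorphM.
Qed.

Lemma cycle_has_subgraph_iso n k (G : rel 'I_n) (s : seq 'I_n) :
  (forall u v, G u v = G v u) -> uniq s -> cycle G s -> size s = k -> (0 < k)%N ->
  has_subgraph_iso G (@cycle_graph k).
Proof.
case: s => [_ _ _ <- //|x p] sG us cs sk k0.
pose f (i : 'I_k) := nth x (x :: p) i.
have f_inj : injective f.
  move=> i j /eqP; rewrite /f nth_uniq ?sk // => /eqP; exact: val_inj.
have Hs i j : @cycle_graph k i j = cycle_graph j i by rewrite /cycle_graph orbC.
have Gs (i j : 'I_k) : j == (i + 1)%N %[mod k] -> G (f i) (f j).
  have /pathP pG := cs; have := pG x i.
  rewrite size_rcons -[X in (_ < X)%N]/(size (x :: p)) sk.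
  move=> /(_ (ltn_ord i)); rewrite -rcons_cons nth_rcons sk ltn_ord -/(f i).
  rewrite nth_rcons modn_small // addn1 => Gi /eqP ji.
  (* The closed walk ends in [x], which is also the value of [f] at the index 0 that follows the
     last one modulo [k]. *)
  suff <- : (if (i < size p)%N then nth x p i else if i == size p :> nat then x else x) = f j.
    exact: Gi.
  have kE : k = (size p).+1 by rewrite -sk.
  rewrite /f ji; case: ltnP => ip; first by move: ip; rewrite -ltnS -kE => ik; rewrite modn_small.
  have -> : (i : nat) = size p by apply/eqP; rewrite eqn_leq ip andbT -ltnS -kE.
  by rewrite eqxx -kE modnn.
have GH i j : cycle_graph i j -> G (f i) (f j).
  by case/orP=> [/Gs|/Gs//]; rewrite sG.
(* The edges are the image of the cycle, not the restriction of [G], which may have chords. *)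
exists (f @: setT),
  (fun u v => [exists i, exists j, [&& cycle_graph i j, f i == u & f j == v]]), f.
split; [|split; [|split; [|split; [|split]]]] => //.
- move=> u v /existsP[i /existsP[j /and3P[ij /eqP <- /eqP <-]]].
  by rewrite GH // !imset_f.
- move=> u v; apply/existsP/existsP => -[i /existsP[j /and3P[ij fi fj]]];
    by exists j; apply/existsP; exists i; rewrite Hs ij fi fj.
- by move=> v /imsetP[i _ ->]; exists i.
- by move=> i; apply: imset_f.
- move=> i j; apply/idP/existsP => [ij|[i' /existsP[j' /and3P[ij /eqP/f_inj<- /eqP/f_inj<-]]]] //.
  by exists i; apply/existsP; exists j; rewrite ij !eqxx.
Qed.

Lemma val_iter_ordS k m (i : 'I_k) : val (iter m (@ordS k) i) = ((i + m) %% k)%N.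
Proof.
elim: m => [|m IHm] /=; first by rewrite addn0 modn_small.
by rewrite IHm -addn1 modnDml addn1 addnS.
Qed.

Lemma iter_ordS_neq k m (i : 'I_k) : (0 < m < k)%N -> iter m (@ordS k) i != i.
Proof.
case/andP=> m0 mk; apply/eqP => /(congr1 val); rewrite val_iter_ordS /= => e.
have : i + m == i + 0 %[mod k] by rewrite e addn0 modn_small.
by rewrite eqn_modDl mod0n modn_small // eqn0Ngt m0.
Qed.

(** If the matrix of [odd_cycle_dnn] were cpsd, the robust inequality would bound a sum of terms
    [>= 2] by a sum of as many terms [2 - dl + 6 * eta < 2]. *)
Lemma odd_cycle_not_cpsd_graph n t (G : rel 'I_n) : simple_graph G -> (2 <= t)%N ->
  has_subgraph_iso G (@cycle_graph (2 * t + 1)) -> ~ @cpsd_graph R n G.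
Proof.
move=> [irrG symG] t2 [V [E [f [EG [_ [f_inj [_ [_ fE]]]]]]]] cG.
set k := (2 * t + 1)%N in f f_inj fE.
have k5 : (5 <= k)%N by rewrite /k; lia.
have Gf i : G (f i) (f (ordS i)).
  have /EG/and3P[] // : E (f i) (f (ordS i)).
  rewrite -fE /cycle_graph; apply/orP; right.
  by rewrite addn1 modn_small // [val (ordS i)]/=.
have oddk : odd k by rewrite /k oddD oddM.
have iterk (i : 'I_k) : iter k (@ordS k) i = i.
  by apply: val_inj; rewrite val_iter_ordS modnDr modn_small.
have nx m (i : 'I_k) : (0 < m < 4)%N -> iter m (@ordS k) i != i.
  by move=> m4; apply: iter_ordS_neq; lia.
have [dl [dl0 dl1 mat]] := @odd_cycle_dnn R _ _ (@ordS k) f k G (@ordS_inj k) f_inj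
  oddk iterk (fun i => nx 1%N i isT) (fun i => nx 2%N i isT) (fun i => nx 3%N i isT) symG irrG Gf.
(* With [ep = eta ^+ 2] and [eta <= 1], the denominator [n + 7] ensures both [ep * n <= dl] and
   [6 * eta < dl]. *)
pose eta := dl / (n.+1 + 6)%:R.
have eta0 : 0 < eta by rewrite divr_gt0 // ltr0n.
have etan : eta * (n.+1 + 6)%:R = dl by rewrite divfK // pnatr_eq0.
have eta_le : eta * n%:R <= dl by rewrite -etan ler_wpM2l ?ler_nat ?ltW //; lia.
have eta1 : eta <= 1.
  apply: le_trans dl1; rewrite -etan ler_peMr ?ler1n // ltW //.
have eta6 : 6 * eta < dl.
  by rewrite -etan mulrC ltr_pM2l // ltr_nat; lia.
have ep0 : 0 < eta ^+ 2 by rewrite exprn_gt0.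
have epn : eta ^+ 2 * #|'I_n|%:R <= dl.
  rewrite card_ord expr2 -mulrA; apply: le_trans eta_le; apply: ler_piMl eta1.
  by apply: mulr_ge0; rewrite ?ler0n ?(ltW eta0).
have [M [pM [M0 MG] Mnext Mdiag Mfar]] := mat _ ep0 epn.
pose X : 'M[R]_n := \matrix_(i, j) M i j.
have XE i j : X i j = M i j by rewrite mxE.
have dX : DNN X.
  split=> [|i j]; last by rewrite XE.
  apply/psd_realP; case: pM => sM pM; split=> [i j|x]; first by rewrite !XE.
  by rewrite (eq_bform (M' := M)).
have sX : support_graph X =2 G by move=> i j; rewrite /support_graph XE.
have [d [P [_ [pP XP]]]] := cG X dX sX.
have trP i j : \tr (P i *m P j) = ((M i j)%:C)%C by rewrite -XP XE.
have ppsd i : mxpsd (P i).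
  by have [hP pos] := pP i; split=> [|v]; rewrite -adjmxE.
have natC m : m%:R = ((m%:R)%:C)%C :> R[i] by rewrite rmorph_nat.
have near i : \tr (P (f i) *m P (f i)) <= 2.
  by rewrite trP Mdiag (natC 2) lecR gerBl ltW.
have far i : \tr (P (f (ordS (ordS i))) *m P (f i)) <= (eta%:C)%C ^+ 2.
  by rewrite trP -rmorphXn lecR.
have etaC0 : 0 < (eta%:C)%C :> R[i] by rewrite ltcR.
have := robust_cycle_inequality (@ordS_inj k) etaC0 (fun i => ppsd (f i)) near far.
have -> : \sum_i 2 * \tr (P (f i) *m P (f (ordS i)))
    = ((\sum_i 2 * M (f i) (f (ordS i)))%:C)%C :> R[i].
  by rewrite rmorph_sum; apply: eq_bigr => i _; rewrite trP (natC 2) -rmorphM.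
have -> : \sum_i (\tr (P (f i) *m P (f i)) + 6 * (eta%:C)%C)
    = ((\sum_i (M (f i) (f i) + 6 * eta))%:C)%C :> R[i].
  by rewrite rmorph_sum; apply: eq_bigr => i _; rewrite trP (natC 6) -rmorphM -rmorphD.
rewrite lecR; apply/negP; rewrite -ltNge.
apply: ltr_sum => [|i _]; last by rewrite Mdiag; have := Mnext i; lra.
by apply/hasP; exists (Ordinal (leq_trans (isT : (0 < 5)%N) k5)); rewrite ?mem_index_enum.
Qed.

End CpsdMatrices.

Theorem theorem6p5 (R : realType) (n : nat) (G : rel 'I_n) :
  simple_graph G ->
  (@cpsd_graph R n G <->
   ~ (exists t : nat, (2 <= t)%N /\ has_subgraph_iso G (@cycle_graph (2 * t + 1)%N))).
Proof.
move=> sG; split=> [cG [t [t2 iso]]|no_cycle X [pX X0] XG].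
  exact: odd_cycle_not_cpsd_graph sG t2 iso cG.
apply: cp_cpsd; apply: dnn_completely_positive => [|s us cs os].
  by split=> //; apply/psd_realP.
rewrite ltnNge; apply/negP => s5; apply: no_cycle; exists (size s)./2.
have sE : size s = (2 * (size s)./2 + 1)%N.
  by rewrite mul2n -{1}(odd_double_half (size s)) os addnC.
split; first by lia.
apply: (@cycle_has_subgraph_iso _ _ _ s) => //; [exact: sG.2 | | by lia].
by case: s cs {us os s5 sE} => //= x s; apply: sub_path => u v; rewrite -XG.
Qed.
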